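(* Let $H$ be a finite-dimensional Hopf quasigroup over a field $k$, let $\lambda\in H^*$ be a left integral on $H$, let $\Lambda\in H$ be a right integral on $H^*$, and suppose $\mu:=\lambda(\Lambda)\neq 0$. Let $F:H\to H^*$ be the Fourier transformation $F(h)=\lambda\leftharpoondown h$, i.e. $F(h)(x)=\lambda(x\,S(h))$ for $x\in H$, and define $F^{-1}:H^*\to H$ by $$F^{-1}(\varphi)=\frac1\mu\,(\varphi\rightharpoonup\Lambda)=\frac1\mu\,\Lambda_{(1)}\varphi(\Lambda_{(2)}).$$ Then $F$ and $F^{-1}$ are mutually inverse.
   Context: Let $k$ be a field. A Hopf quasigroup over $k$ is a $k$-vector space $H$ with a unital, not necessarily associative, bilinear product, together with (unital) algebra homomorphisms $\Delta:H\to H\otimes H$ and $\varepsilon:H\to k$ forming a coassociative counital coalgebra, and a linear map $S:H\to H$ (the antipode) such that, in Sweedler notation $\Delta h=h_{(1)}\otimes h_{(2)}$ (summation omitted), for all $h,g\in H$: $S(h_{(1)})(h_{(2)}g)=h_{(1)}(S(h_{(2)})g)=(gS(h_{(1)}))h_{(2)}=(gh_{(1)})S(h_{(2)})=\varepsilon(h)g$. A left integral on $H$ is $\lambda\in H^*$ such that $h_{(1)}\lambda(h_{(2)})=\lambda(h)1$ for all $h\in H$. The dual $H^*$ has product $(\varphi\psi)(h)=\varphi(h_{(1)})\psi(h_{(2)})$, unit $\varepsilon$, and coproduct $\Delta\varphi=\varphi_{(1)}\otimes\varphi_{(2)}$ determined by $\varphi_{(1)}(h)\varphi_{(2)}(g)=\varphi(hg)$.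 A right integral on $H^*$ is an element $\Lambda\in H\cong H^{**}$ such that $\varphi_{(1)}(\Lambda)\varphi_{(2)}=\varphi(\Lambda)\,\varepsilon$ for all $\varphi\in H^*$; equivalently, $\Lambda h=\varepsilon(h)\Lambda$ for all $h\in H$. The right action of $H$ on $H^*$ is $(\varphi\leftharpoondown h)(x)=\varphi(x\,S(h))$, and the left action of $H^*$ on $H$ is $\varphi\rightharpoonup h=h_{(1)}\varphi(h_{(2)})$. *)

(* Defs.v *)
From HB Require Import structures.
From mathcomp Require Import all_boot all_order all_algebra.

Set Implicit Arguments.
Unset Strict Implicit.
Unset Printing Implicit Defensive.

Import GRing.Theory.
Local Open Scope ring_scope.

Reserved Notation "u *t v" (at level 40, left associativity).
Reserved Notation "x ** y" (at level 40, left associativity).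
Reserved Notation "\swd_ ( a , b <- t ) E"
  (at level 41, E at level 41, a name, b name,
   format "'[' \swd_ ( a ,  b  <-  t ) '/  '  E ']'").
Reserved Notation "\swd_ ( a , b : T <- t ) E"
  (at level 41, E at level 41, a name, b name,
   format "'[' \swd_ ( a ,  b  :  T  <-  t ) '/  '  E ']'").

(* Tensor product of finite-dimensional spaces: a tensor is the matrix of its *)
(* coordinates on the products of the vectors of the bases vbasis. The        *)
(* universal property is given by tpure_bilinear, tlift_linear, tlift_pure    *)
(* and tensor_ext.                                                            *)
Section Tensor.
Variable k : fieldType.

Definition bvec (U : vectType k) (i : 'I_(\dim {:U})) : U :=
  (vbasis {:U})`_i.

Definition tensor (U V : vectType k) := 'M[k]_(\dim {:U}, \dim {:V}).
HB.instance Definition _ U V := Vector.on (tensor U V).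

Definition tpure (U V : vectType k) (u : U) (v : V) : tensor U V :=
  \matrix_(i, j) (coord (vbasis {:U}) i u * coord (vbasis {:V}) j v).

(* The value at t of the linear map on tensor U V induced by f, when f is     *)
(* bilinear.                                                                  *)
Definition tlift (U V : vectType k) (W : lmodType k) (f : U -> V -> W)
    (t : tensor U V) : W :=
  \sum_i \sum_j t i j *: f (bvec i) (bvec j).

End Tensor.

Notation "u *t v" := (tpure u v) : ring_scope.

(* Sweedler summation: if t is the sum of the a_s *t b_s, then                *)
(* \swd_(a, b <- t) E a b is the sum of the E a_s b_s, for E bilinear.        *)
Notation "\swd_ ( a , b <- t ) E" := (tlift (fun a b => E) t) : ring_scope.
Notation "\swd_ ( a , b : T <- t ) E" :=
  (tlift (fun a b : T => E) t) (only parsing) : ring_scope.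

Section TensorTheory.
Variable k : fieldType.

Lemma bvec_sum (U : vectType k) (u : U) :
  u = \sum_i coord (vbasis {:U}) i u *: bvec i.
Proof. exact: coord_vbasis (memvf u). Qed.

Lemma coord_bvec (U : vectType k) (i j : 'I_(\dim {:U})) :
  coord (vbasis {:U}) i (bvec j) = (i == j)%:R.
Proof. by rewrite coord_free ?(basis_free (vbasisP _)) // eq_sym. Qed.

Variables U V : vectType k.

Lemma tlift_linear (W : lmodType k) (f : U -> V -> W) : linear (tlift f).
Proof.
move=> a s t; rewrite scaler_sumr -big_split; apply: eq_bigr => i _ /=.
rewrite scaler_sumr -big_split; apply: eq_bigr => j _ /=.
by rewrite !mxE scalerDl scalerA.
Qed.

HB.instance Definition _ (W : lmodType k) (f : U -> V -> W) :=
  GRing.isLinear.Build k (tensor U V) W _ (tlift f) (tlift_linear f).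

Lemma tlift_pure (W : lmodType k) (f : U -> V -> W) u v :
  bilinear_for *:%R *:%R f -> \swd_(a, b <- u *t v) f a b = f u v.
Proof.
case=> fl fr.
pose gl y : {linear U -> W} :=
  HB.pack (fun x => f x y) (GRing.isLinear.Build _ _ _ _ _ (fl y)).
pose gr x : {linear V -> W} :=
  HB.pack (f x) (GRing.isLinear.Build _ _ _ _ _ (fr x)).
rewrite -[RHS]/(gl v u) [X in gl _ X](bvec_sum u) linear_sum.
apply: eq_bigr => i _; rewrite linearZ_LR.
have -> : gl v (bvec i) = gr (bvec i) v by [].
rewrite [X in gr _ X](bvec_sum v) linear_sum scaler_sumr.
by apply: eq_bigr => j _; rewrite linearZ_LR scalerA mxE.
Qed.

Lemma tpure_bilinear : bilinear_for *:%R *:%R (@tpure k U V).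
Proof.
by split=> [v|u] a x y; apply/matrixP=> i j; rewrite !mxE linearP /=;
   rewrite ?mulrDl ?mulrDr ?mulrA // [_ * a]mulrC.
Qed.

Lemma tensor_sum (t : tensor U V) : t = \swd_(a, b <- t) a *t b.
Proof.
rewrite [LHS]matrix_sum_delta; apply: eq_bigr => i _; apply: eq_bigr => j _.
congr (_ *: _); apply/matrixP => i' j'.
by rewrite !mxE !coord_bvec -natrM mulnb.
Qed.

Lemma tensor_ext (W : lmodType k) (f g : {linear tensor U V -> W}) :
  (forall u v, f (u *t v) = g (u *t v)) -> f =1 g.
Proof.
move=> fg t; rewrite [t]tensor_sum /tlift !linear_sum; apply: eq_bigr => i _.
by rewrite !linear_sum; apply: eq_bigr => j _; rewrite !linearZ fg.
Qed.

End TensorTheory.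

(* The three-fold products in coassociativity are both taken in               *)
(* tensor H (tensor H H).                                                     *)
HB.mixin Record Vector_isHopfQuasigroup (k : fieldType) H
    of Vector k H := {
  hqmul : H -> H -> H;
  hqone : H;
  hqdelta : 'Hom(H, tensor H H);
  hqeps : 'Hom(H, k^o);
  hqS : 'End(H);
  hqmul_bilinear : bilinear_for *:%R *:%R hqmul;
  hqmul1x : left_id hqone hqmul;
  hqmulx1 : right_id hqone hqmul;
  hqdeltaM : forall g h, hqdelta (hqmul g h) =
    \swd_(a, b <- hqdelta g) \swd_(c, d <- hqdelta h) hqmul a c *t hqmul b d;
  hqdelta1 : hqdelta hqone = hqone *t hqone;
  hqepsM : forall g h, hqeps (hqmul g h) = hqeps g * hqeps h;
  hqeps1 : hqeps hqone = 1;
  hqdeltaA : forall h,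
    \swd_(a, b <- hqdelta h) \swd_(c, d <- hqdelta a) c *t (d *t b) =
    \swd_(a, b <- hqdelta h) a *t hqdelta b;
  hqeps_deltal : forall h, \swd_(a, b <- hqdelta h) hqeps a *: b = h;
  hqeps_deltar : forall h, \swd_(a, b <- hqdelta h) hqeps b *: a = h;
  hqSl1 : forall h g,
    \swd_(a, b <- hqdelta h) hqmul (hqS a) (hqmul b g) = hqeps h *: g;
  hqSl2 : forall h g,
    \swd_(a, b <- hqdelta h) hqmul a (hqmul (hqS b) g) = hqeps h *: g;
  hqSr1 : forall h g,
    \swd_(a, b <- hqdelta h) hqmul (hqmul g (hqS a)) b = hqeps h *: g;
  hqSr2 : forall h g,
    \swd_(a, b <- hqdelta h) hqmul (hqmul g a) (hqS b) = hqeps h *: g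
}.

#[short(type="hopfQuasigroupType")]
HB.structure Definition HopfQuasigroup (k : fieldType) :=
  {H of Vector k H & Vector_isHopfQuasigroup k H}.

Notation "x ** y" := (hqmul x y) : ring_scope.

HB.instance Definition _ (k : fieldType) (H : hopfQuasigroupType k) :=
  bilinear_isBilinear.Build k H H H _ _ (@hqmul k H) hqmul_bilinear.

Definition dual (k : fieldType) (V : vectType k) := 'Hom(V, k^o).
HB.instance Definition _ k V := Vector.on (@dual k V).

Section HopfQuasigroupDual.
Variables (k : fieldType) (H : hopfQuasigroupType k).
Implicit Types (phi : dual H) (g h x : H).

(* The basis of dual H that is dual to bvec.                                  *)
Definition dual_bvec (i : 'I_(\dim {:H})) : dual H :=
  linfun (coord (vbasis {:H}) i : H -> k^o).

(* The coproduct of dual H, determined by dual_deltaE.                        *)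
Definition dual_delta phi : tensor (dual H) (dual H) :=
  \sum_i \sum_j phi (bvec i ** bvec j) *: (dual_bvec i *t dual_bvec j).

Definition left_integral (lambda : dual H) : Prop :=
  forall h, \swd_(a, b <- hqdelta h) lambda b *: a =
    (lambda h : k) *: (hqone : H).

Definition right_integral_dual (Lambda : H) : Prop :=
  forall phi, \swd_(psi, chi : dual H <- dual_delta phi) psi Lambda *: chi =
    (phi Lambda : k) *: (hqeps : dual H).

Definition rmulq g : 'End(H) := linfun (fun x => x ** g).

Definition dual_ract phi h : dual H := (phi \o rmulq (hqS h))%VF.

Definition dual_lact phi h : H := \swd_(a, b <- hqdelta h) phi b *: a.

Definition fourier (lambda : dual H) (h : H) : dual H := dual_ract lambda h.

Definition fourier_inv (lambda : dual H) (Lambda : H) phi : H :=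
  (lambda Lambda : k)^-1 *: dual_lact phi Lambda.

Lemma dual_ractE phi h x : dual_ract phi h x = phi (x ** hqS h).
Proof. by rewrite comp_lfunE (lfunE (applyr hqmul (hqS h))). Qed.

Lemma dual_deltaE phi g h :
  \swd_(psi, chi : dual H <- dual_delta phi) (psi g * chi h : k^o) =
  phi (g ** h).
Proof.
have f_bilin : bilinear_for *:%R *:%R
    (fun psi chi : dual H => psi g * chi h : k^o).
  split=> [v|u] a x y; rewrite add_lfunE scale_lfunE ?mulrDl ?mulrDr.
    by congr (_ + _); rewrite -[LHS]mulrA.
  by congr (_ + _); rewrite -[LHS]mulrCA.
rewrite /dual_delta linear_sum [in RHS](bvec_sum g).
rewrite (linear_sumlz hqmul) [RHS]linear_sum; apply: eq_bigr => i _.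
rewrite linear_sum linearZl_LR [in RHS](bvec_sum h).
rewrite (linear_sumr hqmul) [RHS]linearZ_LR [X in _ = _ *: X]linear_sum.
rewrite [RHS]scaler_sumr.
apply: eq_bigr => j _.
rewrite (linearZr_LR hqmul) [X in _ = _ *: X]linearZ_LR [LHS]linearZ_LR.
rewrite /= (tlift_pure _ _ f_bilin) !lfunE /=.
by rewrite [LHS]mulrC -[LHS]mulrA.
Qed.

End HopfQuasigroupDual.

(* Main.v *)
From HB Require Import structures.
Require Import Defs.
From mathcomp Require Import all_boot all_order all_algebra.
Import GRing.Theory.
Local Open Scope ring_scope.

(** Everything rests on one identity: a right integral Lambda on the dual lets
    an element h move from the second leg of its coproduct to the first,
      Lambda_1 # (Lambda_2 S(h)) = (Lambda_1 h) # Lambda_2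
    (lemma [integral_shift], stated after applying lambda to the second leg).
    Starting from the right-hand side, the quasigroup law
    (x h_1) S(h_2) = eps(h) x inserts a cancelling pair in the second leg:
      (Lambda_1 h) # Lambda_2
        = (Lambda_1 h_1) # ((Lambda_2 h_2) S(h_3))
        = (Lambda h_1)_1 # ((Lambda h_1)_2 S(h_2))
        = Lambda_1 # (Lambda_2 S(h)),
    by multiplicativity of the coproduct and then Lambda h_1 = eps(h_1) Lambda.
    The bracketing (Lambda_2 h_2) S(h_3) is both the one that the quasigroup law
    cancels and the one that exposes the second leg of Lambda h_1, which is why
    the argument survives in a non-associative product.

    Applying lambda to the second leg and using the left integral property
    Lambda_1 lambda(Lambda_2) = lambda(Lambda) 1 turns the right-hand side into
    mu h, hence the inverse transform of F(h) is h ([fourierK]).  The other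
    composite is then the identity because F is an injective linear map between
    spaces of equal finite dimension. *)

Set Implicit Arguments.
Unset Strict Implicit.
Unset Printing Implicit Defensive.

Section SweedlerSums.
Variables (k : fieldType) (U V : vectType k).

Lemma eq_tlift (W : lmodType k) (f g : U -> V -> W) (t : tensor U V) :
  f =2 g -> tlift f t = tlift g t.
Proof.
by move=> fg; apply: eq_bigr => i _; apply: eq_bigr => j _; rewrite fg.
Qed.

Lemma linear_tlift (W W' : lmodType k) (L : {linear W -> W'})
    (f : U -> V -> W) (t : tensor U V) :
  L (tlift f t) = \swd_(a, b <- t) L (f a b).
Proof.
rewrite linear_sum; apply: eq_bigr => i _.
by rewrite linear_sum; apply: eq_bigr => j _; rewrite linearZ.
Qed.

(** The version of [linear_tlift] for maps such as x |-> x ** h that carry no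
    canonical linear structure. *)
Lemma tlift_linear_map (W W' : lmodType k) (L : W -> W') (f : U -> V -> W)
    (t : tensor U V) :
  linear L -> L (tlift f t) = \swd_(a, b <- t) L (f a b).
Proof.
move=> L_lin; pose L' : {linear W -> W'} :=
  HB.pack L (GRing.isLinear.Build _ _ _ _ _ L_lin).
exact: (linear_tlift L').
Qed.

Lemma tliftZ (W : lmodType k) (c : k) (f : U -> V -> W) (t : tensor U V) :
  \swd_(a, b <- t) (c *: f a b) = c *: tlift f t.
Proof.
rewrite scaler_sumr; apply: eq_bigr => i _; rewrite scaler_sumr.
by apply: eq_bigr => j _; rewrite !scalerA mulrC.
Qed.

Lemma tliftD (W : lmodType k) (f g : U -> V -> W) (t : tensor U V) :
  \swd_(a, b <- t) (f a b + g a b) = tlift f t + tlift g t.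
Proof.
rewrite -big_split; apply: eq_bigr => i _; rewrite -big_split.
by apply: eq_bigr => j _; rewrite /= scalerDr.
Qed.

End SweedlerSums.

Lemma exchange_tlift (k : fieldType) (U V U' V' : vectType k) (W : lmodType k)
    (f : U -> V -> U' -> V' -> W) (s : tensor U V) (t : tensor U' V') :
  \swd_(a, b <- s) \swd_(c, d <- t) f a b c d =
  \swd_(c, d <- t) \swd_(a, b <- s) f a b c d.
Proof.
have pairE (X Y : vectType k) (g : X -> Y -> W) (r : tensor X Y) :
    tlift g r = \sum_p r p.1 p.2 *: g (bvec p.1) (bvec p.2).
  by rewrite /tlift pair_bigA.
rewrite !pairE; under eq_bigr do rewrite pairE scaler_sumr.
rewrite exchange_big; apply: eq_bigr => q _; rewrite pairE scaler_sumr.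
by apply: eq_bigr => p _; rewrite !scalerA mulrC.
Qed.

Lemma dim_dual (k : fieldType) (V : vectType k) :
  \dim {:dual V} = \dim {:V}.
Proof. by rewrite !dimvf; exact: muln1. Qed.

Section FourierTransform.
Variables (k : fieldType) (H : hopfQuasigroupType k).

(** Coassociativity in the form in which Sweedler notation uses it: the axiom
    is an equation between tensors, and a trilinear map factors through the
    three-fold tensor product. *)
Lemma coassoc_tlift (W : lmodType k) (E : H -> H -> H -> W) (h : H) :
  (forall y z, linear (fun x => E x y z)) ->
  (forall x z, linear (fun y => E x y z)) ->
  (forall x y, linear (E x y)) ->
  \swd_(p, q <- hqdelta h) \swd_(r, s <- hqdelta p) E r s q =
  \swd_(p, q <- hqdelta h) \swd_(r, s <- hqdelta q) E p r s.
Proof.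
move=> E1 E2 E3.
pose G (x : H) (t : tensor H H) : W := \swd_(y, z <- t) E x y z.
have Gbil : bilinear_for *:%R *:%R G.
  split=> [t|x] a u v; last by rewrite /G linearP.
  transitivity (a *: tlift (E u) t + tlift (E v) t) => //.
  rewrite -tliftZ -tliftD.
  by apply: eq_tlift => y z; rewrite E1.
have GE x y z : tlift G (x *t (y *t z)) = E x y z.
  by rewrite tlift_pure // /G tlift_pure.
have := congr1 (tlift G) (hqdeltaA h).
rewrite !linear_tlift => eqG.
transitivity (\swd_(a, b <- hqdelta h) tlift G (a *t hqdelta b)); last first.
  by apply: eq_tlift => p q; rewrite tlift_pure.
rewrite -eqG; apply: eq_tlift => p q; rewrite linear_tlift.
by apply: eq_tlift => r s; rewrite /= GE.
Qed.

(** Evaluating the defining equation of the integral at h gives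
    phi(Lambda h) = phi(Lambda) eps(h), and the forms phi separate points. *)
Lemma right_integral_dualE (Lambda : H) : right_integral_dual Lambda ->
  forall h, Lambda ** h = (hqeps h : k) *: Lambda.
Proof.
move=> LambdaI h.
suff same phi : (phi : dual H) (Lambda ** h) = (hqeps h : k) *: phi Lambda.
  rewrite [LHS]bvec_sum [RHS]bvec_sum; apply: eq_bigr => i _; congr (_ *: _).
  by have := same (dual_bvec i); rewrite !lfunE /= => ->; rewrite linearZ.
have evh_lin : linear (fun chi : dual H => chi h : k^o).
  by move=> c u v; rewrite add_lfunE scale_lfunE.
have := congr1 (fun chi : dual H => chi h : k^o) (LambdaI phi).
rewrite (tlift_linear_map _ _ evh_lin) scale_lfunE => eq_h.
rewrite -dual_deltaE [RHS]mulrC -[RHS]eq_h.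
by apply: eq_tlift => psi chi; rewrite scale_lfunE.
Qed.

(** Insert (x h_2) S(h_3) into the second leg on the right, regroup by
    coassociativity, and let Lambda absorb the product Lambda ** h_1. *)
Lemma integral_shift (lambda : dual H) (Lambda h : H) :
  right_integral_dual Lambda ->
  \swd_(a, b <- hqdelta Lambda) (lambda (b ** hqS h) : k) *: a =
  \swd_(a, b <- hqdelta Lambda) (lambda b : k) *: (a ** h).
Proof.
move=> LambdaI.
pose T x a b : H := (lambda (b ** hqS x) : k) *: a.
have T_bil x : bilinear_for *:%R *:%R (T x).
  split=> [b|a] c u v; rewrite /T; first by rewrite linearP.
  by rewrite (linearPl hqmul) linearP scalerDl -scalerA.
pose E a b x y z : H := (lambda ((b ** y) ** hqS z) : k) *: (a ** x).
(* (a h) # b = (a h_1) # ((b h_2) S(h_3)), with h_2 # h_3 the coproduct of    *)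
(* the second leg of h.                                                       *)
have expand a b : (lambda b : k) *: (a ** h) =
    \swd_(p, q <- hqdelta h) \swd_(r, s <- hqdelta q) E a b p r s.
  have inner p q : \swd_(r, s <- hqdelta q) E a b p r s =
      (lambda b : k) *: (a ** ((hqeps q : k) *: p)).
    have L_lin : linear (fun w => (lambda w : k) *: (a ** p)).
      by move=> c u v; rewrite linearP scalerDl scalerA.
    rewrite -(tlift_linear_map _ _ L_lin) hqSr2 linearZ linearZr_LR scalerA.
    by rewrite mulrC.
  have L_lin : linear (fun w => (lambda b : k) *: (a ** w)).
    by move=> c u v; rewrite (linearPr hqmul) linearP.
  under eq_tlift do rewrite inner.
  by rewrite -(tlift_linear_map _ _ L_lin) hqeps_deltar.
(* The legs of Lambda and p multiply to the coproduct of                      *)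
(* Lambda ** p = eps(p) Lambda.                                               *)
have collapse p q :
    \swd_(a, b <- hqdelta Lambda) \swd_(r, s <- hqdelta p) E a b r s q
    = (hqeps p : k) *: \swd_(a, b <- hqdelta Lambda) T q a b.
  transitivity (tlift (T q) (hqdelta (Lambda ** p))); last first.
    by rewrite right_integral_dualE // !linearZ.
  rewrite hqdeltaM linear_tlift; apply: eq_tlift => a b.
  rewrite linear_tlift; apply: eq_tlift => r s.
  by rewrite /= (tlift_pure _ _ (T_bil q)).
symmetry; transitivity (\swd_(a, b <- hqdelta Lambda)
    \swd_(p, q <- hqdelta h) \swd_(r, s <- hqdelta p) E a b r s q).
  apply: eq_tlift => a b; rewrite expand coassoc_tlift //.
  - by move=> y z c u v; rewrite /E (linearPr hqmul) linearP.
  - move=> x z c u v; rewrite /E (linearPr hqmul) (linearPl hqmul) linearP.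
    by rewrite scalerDl scalerA.
  - move=> x y c u v; rewrite /E [hqS _]linearP (linearPr hqmul) linearP.
    by rewrite scalerDl scalerA.
rewrite exchange_tlift; under eq_tlift do rewrite collapse -tliftZ.
rewrite exchange_tlift; apply: eq_tlift => a b.
have L_lin : linear (fun w => T w a b).
  move=> c u v; rewrite /T [hqS _]linearP (linearPr hqmul) linearP.
  by rewrite scalerDl scalerA.
rewrite -[RHS]/(T h a b) -[in RHS](hqeps_deltal h).
rewrite (tlift_linear_map _ _ L_lin); apply: eq_tlift => x y.
rewrite /T [hqS (_ *: _)]linearZ_LR (linearZr_LR hqmul).
by rewrite [lambda (_ *: _)]linearZ_LR scalerA.
Qed.

Lemma fourierK (lambda : dual H) (Lambda : H) :
  left_integral lambda -> right_integral_dual Lambda ->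
  lambda Lambda != 0 -> cancel (fourier lambda) (fourier_inv lambda Lambda).
Proof.
move=> lambdaI LambdaI mu_neq0 h; rewrite /fourier_inv /dual_lact.
under eq_tlift do rewrite dual_ractE.
rewrite integral_shift //.
have L_lin : linear (fun a => a ** h).
  by move=> c u v; rewrite (linearPl hqmul).
transitivity ((lambda Lambda : k)^-1 *: ((lambda Lambda : k) *: h)); last first.
  by rewrite scalerA mulVf // scale1r.
congr (_ *: _); rewrite -{2}(hqmul1x h) -linearZl_LR -lambdaI /=.
rewrite (tlift_linear_map _ _ L_lin); apply: eq_tlift => a b.
by rewrite (linearZl_LR hqmul).
Qed.

Lemma fourier_linear (lambda : dual H) : linear (fourier lambda).
Proof.
move=> c u v; apply/lfunP => x.
by rewrite add_lfunE scale_lfunE !dual_ractE !(linearP, linearPr).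
Qed.

End FourierTransform.

Unset Implicit Arguments.

Theorem mainTheorem5 (k : fieldType) (H : hopfQuasigroupType k)
    (lambda : dual H) (Lambda : H)
    (lambda_int : left_integral lambda)
    (Lambda_int : right_integral_dual Lambda)
    (mu_neq0 : lambda Lambda != 0) :
  cancel (fourier lambda) (fourier_inv lambda Lambda) /\
  cancel (fourier_inv lambda Lambda) (fourier lambda).
Proof.
have FK := fourierK lambda_int Lambda_int mu_neq0.
split=> // phi.
pose F : {linear H -> dual H} := HB.pack (fourier lambda)
  (GRing.isLinear.Build _ _ _ _ _ (fourier_linear lambda)).
have kerF : lker (linfun F) == 0%VS.
  by apply/lker0P => u v; rewrite !lfunE /= => /(can_inj FK).
have imF : limg (linfun F) = fullv.
  apply/eqP; rewrite eqEdim subvf limg_dim_eq ?dim_dual //=.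
  by rewrite (eqP kerF) capv0.
have /memv_imgP[h _ ->] : phi \in limg (linfun F) by rewrite imF memvf.
by rewrite lfunE /= FK.
Qed.
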